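(* Let $(H;\langle\cdot,\cdot\rangle)$ be an inner product space over $\mathbb{K}$ and let $x,y\in H$, $\gamma,\Gamma\in\mathbb{K}$ be such that either $$\operatorname{Re}\langle \Gamma y-x,\,x-\gamma y\rangle\ge 0,$$ or, equivalently, $$\left\|x-\frac{\Gamma+\gamma}{2}y\right\|\le\frac12|\Gamma-\gamma|\,\|y\|$$ holds. (i) If $\operatorname{Re}(\Gamma\overline{\gamma})>0$, then $$\|x\|^2\|y\|^2\le\frac14\cdot\frac{\{\operatorname{Re}[(\overline{\Gamma}+\overline{\gamma})\langle x,y\rangle]\}^2}{\operatorname{Re}(\Gamma\overline{\gamma})}\le\frac14\cdot\frac{|\Gamma+\gamma|^2}{\operatorname{Re}(\Gamma\overline{\gamma})}|\langle x,y\rangle|^2 .$$ The constant $\frac14$ is best possible in both inequalities (i.e. in each of the two upper bounds for $\|x\|^2\|y\|^2$). (ii) If $\operatorname{Re}(\Gamma\overline{\gamma})=0$, then $$\|x\|^2\le\operatorname{Re}[(\overline{\Gamma}+\overline{\gamma})\langle x,y\rangle]\le|\Gamma+\gamma|\,|\langle x,y\rangle| .$$ (iii) If $\operatorname{Re}(\Gamma\overline{\gamma})<0$, then $$\|x\|^2\le-\operatorname{Re}(\Gamma\overline{\gamma})\|y\|^2+\operatorname{Re}[(\overline{\Gamma}+\overline{\gamma})\langle x,y\rangle]\le-\operatorname{Re}(\Gamma\overline{\gamma})\|y\|^2+|\Gamma+\gamma|\,|\langle x,y\rangle| .$$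
   Context: $\mathbb{K}$ is $\mathbb{R}$ or $\mathbb{C}$; the inner product is linear in its first argument and $\|z\|=\sqrt{\langle z,z\rangle}$. A constant is called best possible if no smaller constant makes the corresponding inequality valid for all inner product spaces over $\mathbb{K}$ and all data satisfying the hypotheses. *)

(* Defs.v *)
From HB Require Import structures.
From mathcomp Require Import all_boot all_order all_algebra.
From mathcomp Require Import reals.
From mathcomp Require Import complex.

Set Implicit Arguments.
Unset Strict Implicit.
Unset Printing Implicit Defensive.

Import Order.TTheory GRing.Theory Num.Theory.
Local Open Scope ring_scope.

Variant scalar_kind := RealScalars | ComplexScalars.

(* [RCfield R k] is the field K, that is, either R or R[i]. *)
Definition RCfield (R : realType) (k : scalar_kind) : numFieldType :=
  match k with
  | RealScalars => R
  | ComplexScalars => R[i]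
  end.

Definition sconj (R : realType) (k : scalar_kind) :
    {rmorphism RCfield R k -> RCfield R k} :=
  match k return {rmorphism RCfield R k -> RCfield R k} with
  | RealScalars => idfun
  | ComplexScalars => Num.conj
  end.

Definition sre (R : realType) (k : scalar_kind) : RCfield R k -> R :=
  match k return RCfield R k -> R with
  | RealScalars => fun z => z
  | ComplexScalars => fun z => complex.Re z
  end.

(* The library norm on K takes values in K (it is a nonnegative real number
   there); [sabs] is the same modulus viewed in R. *)
Definition sabs (R : realType) (k : scalar_kind) (z : RCfield R k) : R :=
  sre `|z|.

(* [{dot H for sconj R k}]: linear in the first argument, conjugate-linear in
   the second, hermitian and positive definite. *)
Definition ipnorm (R : realType) (k : scalar_kind) (H : lmodType (RCfield R k))
    (ip : {dot H for sconj R k}) (z : H) : R :=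
  Num.sqrt (sre (ip z z)).

Definition re_cond (R : realType) (k : scalar_kind) (H : lmodType (RCfield R k))
    (ip : {dot H for sconj R k}) (x y : H) (g G : RCfield R k) : Prop :=
  0 <= sre (ip (G *: y - x) (x - g *: y)).

Definition ball_cond (R : realType) (k : scalar_kind)
    (H : lmodType (RCfield R k)) (ip : {dot H for sconj R k}) (x y : H)
    (g G : RCfield R k) : Prop :=
  ipnorm ip (x - ((G + g) / 2) *: y) <= 1 / 2 * sabs (G - g) * ipnorm ip y.

Definition best_possible (R : realType) (valid : R -> Prop) (c : R) : Prop :=
  valid c /\ forall c' : R, c' < c -> ~ valid c'.

(* Main.v *)
Require Import Defs.
From HB Require Import structures.
From mathcomp Require Import all_boot all_order all_algebra.
From mathcomp Require Import reals.
From mathcomp Require Import complex.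
From mathcomp Require Import ring lra.

Set Implicit Arguments.
Unset Strict Implicit.
Unset Printing Implicit Defensive.

Import Order.TTheory GRing.Theory Num.Theory.
Local Open Scope ring_scope.

(** Everything follows from one identity.  Split the two scalars around their
    midpoint, G = c + d and g = c - d, and put w = x - c y.  The pairing in the
    hypothesis is then <d y - w, d y + w>, whose real part is the difference of
    squares |d|^2 |y|^2 - |w|^2 because the cross terms cancel ([re_pairE]).
    Its nonnegativity is the ball condition ([re_cond_ball]), and expanding
    |w|^2 = |x - c y|^2 turns it into

      |x|^2 + p |y|^2 <= s,   p = Re(G conj g),
                              s = Re((conj G + conj g) <x, y>)

    since p = |c|^2 - |d|^2 ([sre_mul_conjE], [re_cond_le]).  When p <= 0 this
    is already the first bound; when p > 0, squaring it and applying
    4 a b <= (a + b)^2 to the left-hand side gives 4 p |x|^2 |y|^2 <= s^2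
    ([re_cond_mul_le]).  Every second bound is |Re z| <= |z|.

    For the optimality of 1/4, take H = K, x = y = 1 and G = g = 1: for a
    constant c both inequalities then read 1 <= 4 c ([scalar_dot_sample]). *)

(** * Real part and modulus of scalars *)

Section Scalars.
Variables (R : realType) (k : scalar_kind).
Local Notation K := (RCfield R k).
Local Notation sre := (@sre R k).
Local Notation sconj := (sconj R k).
Implicit Types z w : K.

Fact sre_is_zmod_morphism : zmod_morphism sre.
Proof. by case: k => //= -[a b] [c d]. Qed.

HB.instance Definition _ :=
  GRing.isZmodMorphism.Build K R sre sre_is_zmod_morphism.

Lemma sre1 : sre 1 = 1. Proof. by case: k. Qed.

Lemma sre_conj z : sre (sconj z) = sre z.
Proof. by case: k z => //= -[a b]. Qed.

Lemma sconjK : involutive sconj.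
Proof. by case: k => //= z; rewrite conjCK. Qed.

Lemma mul_sconj z : z * sconj z = `|z| ^+ 2.
Proof.
by case: k z => /= z; rewrite ?normCK // real_normK ?num_real.
Qed.

Lemma sre_ge0 z : 0 <= z -> 0 <= sre z.
Proof. by case: k z => //= z; rewrite lecE => /andP[]. Qed.

(** A nonnegative scalar is a real number, so it factors out of the real part.
    In particular the real part is multiplicative on moduli. *)
Lemma sreM_ger0 z w : 0 <= z -> sre (z * w) = sre z * sre w.
Proof.
case: k z w => //= -[a b] [c d]; rewrite lecE /= => /andP[/eqP-> _].
by rewrite mul0r subr0.
Qed.

Lemma sabs_ge0 z : 0 <= sabs z.
Proof. exact: sre_ge0. Qed.

Lemma sabsM z w : sabs (z * w) = sabs z * sabs w.
Proof. by rewrite /sabs normrM sreM_ger0. Qed.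

Lemma sabs_conj z : sabs (sconj z) = sabs z.
Proof. by case: k z => //= z; apply: (congr1 (@complex.Re R)) (norm_conjC z). Qed.

Lemma sabs_nat n : sabs (n%:R : K) = n%:R.
Proof. by rewrite /sabs normr_nat raddfMn /= sre1. Qed.

Lemma sre_sqr_norm z : sre (`|z| ^+ 2) = sabs z ^+ 2.
Proof. by rewrite !expr2 sreM_ger0. Qed.

Lemma sre_mul_sconj z : sre (z * sconj z) = sabs z ^+ 2.
Proof. by rewrite mul_sconj sre_sqr_norm. Qed.

Lemma ler_norm_sre z : `|sre z| <= sabs z.
Proof.
case: k z => //= z; have := normc_ge_Re z.
by rewrite lecE => /andP[].
Qed.

Lemma ler_norm_sreM a z : `|sre (sconj a * z)| <= sabs a * sabs z.
Proof. by rewrite -(sabs_conj a) -sabsM ler_norm_sre. Qed.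

End Scalars.

(** * Inner product spaces *)

(** AM-GM: 4 a (p b) <= (a + p b)^2 <= s^2. *)
Lemma ler_mul_sqr_div (F : realFieldType) (a b p s : F) :
  0 <= a -> 0 <= b -> 0 < p -> a + p * b <= s ->
  a * b <= 1 / 4 * (s ^+ 2 / p).
Proof.
move=> a0 b0 p0 le_s; rewrite mulrA ler_pdivlMr //.
have : (a + p * b) ^+ 2 <= s ^+ 2.
  by rewrite ler_sqr ?nnegrE ?(le_trans _ le_s) // addr_ge0 // mulr_ge0 // ltW.
have := sqr_ge0 (a - p * b).
by nra.
Qed.

Lemma midpoint_split (F : numFieldType) (a b : F) :
  a = (a + b) / 2 + (a - b) / 2 /\ b = (a + b) / 2 - (a - b) / 2.
Proof. by split; field. Qed.

Section InnerProduct.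
Variables (R : realType) (k : scalar_kind).
Local Notation K := (RCfield R k).
Local Notation sre := (@sre R k).
Local Notation sconj := (sconj R k).
Variables (H : lmodType K) (ip : {dot H for sconj}).
Implicit Types (x y u w : H) (a : K).

Lemma ip_sym x y : ip y x = sconj (ip x y).
Proof. by rewrite (hermitian_subproof y x) expr0 mul1r. Qed.

Lemma sre_ip_sym x y : sre (ip y x) = sre (ip x y).
Proof. by rewrite ip_sym sre_conj. Qed.

Lemma ip_ge0 x : 0 <= ip x x.
Proof.
by have [->|x0] := eqVneq x 0; rewrite ?linear0r // ltW // neq0_dnorm_gt0.
Qed.

Lemma ipnorm_ge0 x : 0 <= ipnorm ip x.
Proof. exact: sqrtr_ge0. Qed.

Lemma sqr_ipnorm x : ipnorm ip x ^+ 2 = sre (ip x x).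
Proof. by rewrite sqr_sqrtr ?sre_ge0 ?ip_ge0. Qed.

Lemma ipnormZ a x : ipnorm ip (a *: x) ^+ 2 = sabs a ^+ 2 * ipnorm ip x ^+ 2.
Proof.
rewrite !sqr_ipnorm linearZl_LR linearZr_LR /= mulrA mul_sconj.
by rewrite sreM_ger0 ?exprn_ge0 // sre_sqr_norm.
Qed.

Lemma sqr_ipnormB u w :
  ipnorm ip (u - w) ^+ 2 =
    ipnorm ip u ^+ 2 - 2 * sre (ip u w) + ipnorm ip w ^+ 2.
Proof.
rewrite !sqr_ipnorm linearBl !linearBr !raddfB /= (sre_ip_sym u w).
by ring.
Qed.

(** A polarized difference of squares: the cross terms <u, w> and - <w, u> are
    conjugate up to sign and cancel in the real part. *)
Lemma sre_ipBD u w :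
  sre (ip (u - w) (u + w)) = ipnorm ip u ^+ 2 - ipnorm ip w ^+ 2.
Proof.
rewrite !sqr_ipnorm linearBl !linearDr raddfB !raddfD /= (sre_ip_sym u w).
by ring.
Qed.

Variables (x y : H) (g G : K).
Local Notation c := ((G + g) / 2).
Local Notation d := ((G - g) / 2).

Let GE : G = c + d := (midpoint_split G g).1.
Let gE : g = c - d := (midpoint_split G g).2.

(** With w = x - c y, the two arguments of the pairing are d y - w and
    d y + w. *)
Lemma re_pairE :
  sre (ip (G *: y - x) (x - g *: y)) =
    ipnorm ip (d *: y) ^+ 2 - ipnorm ip (x - c *: y) ^+ 2.
Proof.
rewrite -sre_ipBD; congr (sre (ip _ _)).
- by rewrite {1}GE scalerDl opprB addrCA addrA.
- by rewrite {1}gE scalerBl opprB addrCA addrA.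
Qed.

Lemma sabs_half_diff : sabs d = 1 / 2 * sabs (G - g).
Proof.
have := sabsM d 2; rewrite divfK ?pnatr_eq0 // sabs_nat => ->.
by field.
Qed.

Lemma re_cond_ball : re_cond ip x y g G <-> ball_cond ip x y g G.
Proof.
rewrite /re_cond /ball_cond re_pairE subr_ge0 ipnormZ -exprMn -sabs_half_diff.
by rewrite ler_sqr ?nnegrE ?mulr_ge0 // ?ipnorm_ge0 ?sabs_ge0.
Qed.

(** The cross part d conj c - c conj d of (c + d) conj (c - d) is purely
    imaginary. *)
Lemma sre_mul_conjE : sre (G * sconj g) = sabs c ^+ 2 - sabs d ^+ 2.
Proof.
have cross : sre (d * sconj c) = sre (c * sconj d).
  by rewrite -sre_conj rmorphM sconjK mulrC.
rewrite {1}gE {1}GE rmorphB mulrDl !mulrBr raddfD !raddfB /= cross.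
by rewrite -!sre_mul_sconj; ring.
Qed.

(** The expansion of |x - c y|^2 contributes |c|^2 |y|^2, which combines with
    the term - |d|^2 |y|^2 of the pairing into Re(G conj g) |y|^2. *)
Lemma re_cond_le : re_cond ip x y g G ->
  ipnorm ip x ^+ 2 + sre (G * sconj g) * ipnorm ip y ^+ 2
    <= sre ((sconj G + sconj g) * ip x y).
Proof.
have -> : sre ((sconj G + sconj g) * ip x y) = 2 * sre (ip x (c *: y)).
  have -> : sconj G + sconj g = 2 * sconj c.
    by rewrite -rmorphD fmorph_div rmorph_nat mulrC divfK ?pnatr_eq0.
  by rewrite linearZr_LR /= -mulrA sreM_ger0 // raddfMn /= sre1.
rewrite /re_cond re_pairE sqr_ipnormB !ipnormZ sre_mul_conjE.
by lra.
Qed.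

Lemma ler_norm_sre_sum :
  `|sre ((sconj G + sconj g) * ip x y)| <= sabs (G + g) * sabs (ip x y).
Proof. by rewrite -rmorphD ler_norm_sreM. Qed.

Lemma re_cond_mul_le : re_cond ip x y g G -> 0 < sre (G * sconj g) ->
  ipnorm ip x ^+ 2 * ipnorm ip y ^+ 2 <=
    1 / 4 * (sre ((sconj G + sconj g) * ip x y) ^+ 2 / sre (G * sconj g)).
Proof.
by move=> cond P0; apply: ler_mul_sqr_div; rewrite ?sqr_ge0 // re_cond_le.
Qed.

Lemma sqr_sre_sum_le : 0 < sre (G * sconj g) ->
  1 / 4 * (sre ((sconj G + sconj g) * ip x y) ^+ 2 / sre (G * sconj g)) <=
    1 / 4 * (sabs (G + g) ^+ 2 / sre (G * sconj g)) * sabs (ip x y) ^+ 2.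
Proof.
move=> P0; rewrite -[leRHS]mulrA ler_pM2l; last by lra.
rewrite [leRHS]mulrAC ler_pM2r ?invr_gt0 // -exprMn -real_normK ?num_real //.
by rewrite lerXn2r ?nnegrE ?mulr_ge0 ?sabs_ge0 // ler_norm_sre_sum.
Qed.

End InnerProduct.

(** * The scalar field as an inner product space *)

Section RegularInnerProduct.
Variables (R : realType) (k : scalar_kind).
Local Notation K := (RCfield R k).
Local Notation sconj := (sconj R k).

Definition scalar_ip (a b : K^o) : K := a * sconj b.

Fact scalar_ip_bilinear :
  bilinear_for (GRing.Scale.Law.clone _ _ *%R _)
    (GRing.Scale.Law.clone _ _ (sconj \; *%R) _) scalar_ip.
Proof.
split=> [v|u] a x y /=; rewrite /scalar_ip.
- by rewrite mulrDl -mulrA.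
- by rewrite rmorphD rmorphM mulrDr mulrCA.
Qed.

HB.instance Definition _ :=
  bilinear_isBilinear.Build K K^o K^o K _ _ scalar_ip scalar_ip_bilinear.

Fact scalar_ip_hermitian (a b : K^o) :
  scalar_ip a b = (-1) ^+ false * sconj (scalar_ip b a).
Proof. by rewrite /scalar_ip expr0 mul1r rmorphM sconjK mulrC. Qed.

HB.instance Definition _ :=
  isHermitianSesquilinear.Build K K^o false sconj scalar_ip scalar_ip_hermitian.

Fact scalar_ip_gt0 (a : K^o) : a != 0 -> 0 < scalar_ip a a.
Proof. by move=> a0; rewrite /scalar_ip mul_sconj exprn_gt0 // normr_gt0. Qed.

HB.instance Definition _ := isDotProduct.Build K K^o scalar_ip scalar_ip_gt0.

Definition scalar_dot : {dot K^o for sconj} := scalar_ip.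

(** For G = g the hypothesis forces x = G y: Cauchy-Schwarz is then an equality,
    and no smaller constant is possible in either upper bound. *)
Lemma scalar_dot_sample :
  [/\ re_cond scalar_dot 1 1 1 1, ipnorm scalar_dot 1 ^+ 2 = 1,
      sre (1 * sconj 1) = 1, sre ((sconj 1 + sconj 1) * scalar_dot 1 1) = 2
    & sabs (1 + 1 : K) = 2 /\ sabs (scalar_dot 1 1) = 1].
Proof.
have ip11 : scalar_dot 1 1 = 1 by rewrite /= /scalar_ip rmorph1 mulr1.
rewrite /re_cond sqr_ipnorm ip11 rmorph1 !mulr1 (sabs_nat R k 2) (sabs_nat R k 1).
by rewrite scale1r subrr linear0r !raddf0 raddfD /= sre1.
Qed.

End RegularInnerProduct.

Theorem theorem2 (R : realType) (k : scalar_kind) :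
  (forall (H : lmodType (RCfield R k)) (ip : {dot H for sconj R k})
          (x y : H) (g G : RCfield R k),
    (re_cond ip x y g G <-> ball_cond ip x y g G) /\
    (re_cond ip x y g G \/ ball_cond ip x y g G ->
      [/\ 0 < sre (G * sconj R k g) ->
            ipnorm ip x ^+ 2 * ipnorm ip y ^+ 2 <=
              1 / 4 * (sre ((sconj R k G + sconj R k g) * ip x y) ^+ 2
                         / sre (G * sconj R k g)) /\
            1 / 4 * (sre ((sconj R k G + sconj R k g) * ip x y) ^+ 2
                       / sre (G * sconj R k g)) <=
              1 / 4 * (sabs (G + g) ^+ 2 / sre (G * sconj R k g))
                * sabs (ip x y) ^+ 2,
          sre (G * sconj R k g) = 0 ->
            ipnorm ip x ^+ 2 <= sre ((sconj R k G + sconj R k g) * ip x y) /\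
            sre ((sconj R k G + sconj R k g) * ip x y) <=
              sabs (G + g) * sabs (ip x y)
        & sre (G * sconj R k g) < 0 ->
            ipnorm ip x ^+ 2 <=
              - sre (G * sconj R k g) * ipnorm ip y ^+ 2
                + sre ((sconj R k G + sconj R k g) * ip x y) /\
            - sre (G * sconj R k g) * ipnorm ip y ^+ 2
                + sre ((sconj R k G + sconj R k g) * ip x y) <=
              - sre (G * sconj R k g) * ipnorm ip y ^+ 2
                + sabs (G + g) * sabs (ip x y)])) /\
  best_possible
    (fun c : R =>
      forall (H : lmodType (RCfield R k)) (ip : {dot H for sconj R k})
             (x y : H) (g G : RCfield R k),
        re_cond ip x y g G \/ ball_cond ip x y g G ->
        0 < sre (G * sconj R k g) ->
        ipnorm ip x ^+ 2 * ipnorm ip y ^+ 2 <=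
          c * (sre ((sconj R k G + sconj R k g) * ip x y) ^+ 2
                 / sre (G * sconj R k g)))
    (1 / 4) /\
  best_possible
    (fun c : R =>
      forall (H : lmodType (RCfield R k)) (ip : {dot H for sconj R k})
             (x y : H) (g G : RCfield R k),
        re_cond ip x y g G \/ ball_cond ip x y g G ->
        0 < sre (G * sconj R k g) ->
        ipnorm ip x ^+ 2 * ipnorm ip y ^+ 2 <=
          c * (sabs (G + g) ^+ 2 / sre (G * sconj R k g))
            * sabs (ip x y) ^+ 2)
    (1 / 4).
Proof.
have to_re (H : lmodType (RCfield R k)) (ip : {dot H for sconj R k}) x y g G :
    re_cond ip x y g G \/ ball_cond ip x y g G -> re_cond ip x y g G.
  by case=> // /re_cond_ball.
have [cond xx P S [D I]] := scalar_dot_sample R k.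
split; last split.
- move=> H ip x y g G; split; first exact: re_cond_ball.
  move=> /to_re cnd; have le_S := re_cond_le cnd.
  have le_abs := le_trans (ler_norm _) (ler_norm_sre_sum ip x y g G).
  split.
  + by move=> P0; split; [apply: re_cond_mul_le | apply: sqr_sre_sum_le].
  + by move=> P0; split=> //; rewrite P0 mul0r addr0 in le_S.
  + by move=> _; split; lra.
- split=> [H ip x y g G /to_re|c' lt_c' valid]; first exact: re_cond_mul_le.
  (* At this sample the bound with constant c' is 1 <= 4 c'. *)
  have := valid _ (scalar_dot R k) 1 1 1 1 (or_introl cond).
  by rewrite P xx S => /(_ ltr01); lra.
- split=> [H ip x y g G /to_re cnd P0|c' lt_c' valid].
    exact: le_trans (re_cond_mul_le cnd P0) (sqr_sre_sum_le ip x y P0).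
  (* At this sample the bound with constant c' is 1 <= 4 c'. *)
  have := valid _ (scalar_dot R k) 1 1 1 1 (or_introl cond).
  by rewrite P xx D I => /(_ ltr01); lra.
Qed.
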